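(* Let $A$ be an array of $n$ points in the plane sorted by $x$-coordinate, some of which are marked for deletion, and let $D$ be an array of dividers, such that $A$ and $D$ satisfy Invariants 1–5 stated in the context. Let $C_1$ and $C_2$ be two convex hulls (upper hulls) that are both expressed by $A$ and $D$, i.e. the vertices of $C_i$, in $x$-order, are exactly the unmarked points of $A$ lying in some contiguous index range $R_i$ of $A$, and suppose $C_1$ and $C_2$ are separable by a vertical line. Then the upper common tangent of $C_1$ and $C_2$ can be computed serially in $O(\log n)$ time.
   Context: Representation. Each point $p$ of $A$ stores its coordinates and two pointers $p.\mathrm{LeftPar}$, $p.\mathrm{RightPar}$ to dividers (initially null). A deletion interval $I$ is a contiguous range of positions of $A$, all of whose points are marked for deletion; it is represented by two dividers in $D$: a Left divider $L_I$ (start of $I$) and a Right divider $R_I$ (end of $I$). Each divider stores an $x$-coordinate, a flag saying whether it is Left or Right, a pointer $\mathrm{Landing}$ to a point of $A$, and a pointer $\mathrm{Wrapper}$ to a divider. For $L_I$, $\mathrm{Landing}$ points to the point of $A$ immediately to the left of $I$ (not in $I$); for $R_I$, $\mathrm{Landing}$ points to the point immediately to the right of $I$. A point is marked for deletion iff it lies in at least one deletion interval. Invariants: (1) $|D| = O(n/\log n)$. (2) For any interval $I$ with dividers $L_I,R_I\in D$ and the largest interval $I'$ represented in $D$ with $I\subseteq I'$ (ties broken in favor of the most recently added), $L_I.\mathrm{Wrapper}=L_{I'}$ and $R_I.\mathrm{Wrapper}=R_{I'}$. (3) For any two intervals $I_1,I_2$ represented in $D$, either $I_1\cap I_2=\emptyset$,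 $I_1\subseteq I_2$, or $I_2\subseteq I_1$. (4) For every point $p$ lying in at least one interval, there is one such interval $I$ with $p.\mathrm{LeftPar}=L_I$ and $p.\mathrm{RightPar}=R_I$. (5) For any interval $I$ with $L_I.\mathrm{Wrapper}=L_I$ and $R_I.\mathrm{Wrapper}=R_I$, neither $L_I.\mathrm{Landing}$ nor $R_I.\mathrm{Landing}$ lies in any interval. The upper common tangent of two upper hulls separated by a vertical line is the line lying on or above all points of both hulls and touching each hull; it is reported as the pair of tangency points, one from each hull. *)

(* Defs.v *)
From HB Require Import structures.
From mathcomp Require Import all_boot all_order all_algebra.
From mathcomp Require Import reals.

Set Implicit Arguments.
Unset Strict Implicit.
Unset Printing Implicit Defensive.

Import Order.TTheory GRing.Theory Num.Theory.

Local Open Scope ring_scope.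

(** * Upper hulls and their common tangents *)

Definition point (R : realType) : Type := (R * R)%type.

Definition in_convex_hull (R : realType) (S : seq (point R)) (q : point R) :=
  exists w : 'I_(size S) -> R,
    [/\ forall i, 0 <= w i,
        \sum_i w i = 1,
        q.1 = \sum_i w i * (tnth (in_tuple S) i).1
      & q.2 = \sum_i w i * (tnth (in_tuple S) i).2].

Definition on_or_below_hull (R : realType) (S : seq (point R)) (p : point R) :=
  exists q, [/\ in_convex_hull S q, q.1 = p.1 & p.2 <= q.2].

(* An upper hull is given by its vertices from left to right.  A point of a
   finite set is a vertex of the upper hull of that set iff it is neither on
   nor below the convex hull of the other points. *)
Definition upper_hull (R : realType) (C : seq (point R)) :=
  [/\ C != [::],
      sorted (fun p q : point R => p.1 < q.1) C
    & forall p, p \in C -> ~ on_or_below_hull (rem p C) p].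

Definition separable (R : realType) (C1 C2 : seq (point R)) :=
  exists c : R,
    (forall p q, p \in C1 -> q \in C2 -> p.1 < c < q.1) \/
    (forall p q, p \in C1 -> q \in C2 -> q.1 < c < p.1).

(* The line is y = a x + b.  When a tangent contains an edge of a hull, either
   endpoint of that edge is a tangency point. *)
Definition upper_common_tangent (R : realType) (C1 C2 : seq (point R))
    (p1 p2 : point R) :=
  exists a b : R,
    [/\ forall q, in_convex_hull C1 q \/ in_convex_hull C2 q ->
          q.2 <= a * q.1 + b,
        p1 \in C1 /\ p1.2 = a * p1.1 + b
      & p2 \in C2 /\ p2.2 = a * p2.1 + b].

(** * The arrays A and D *)

(* Pointers into an array are optional indices, [None] being null. *)
Record apoint (R : realType) (m : nat) := APoint {
  xy : point R;
  left_par : option 'I_m;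
  right_par : option 'I_m }.

Record divider (R : realType) (n m : nat) := Divider {
  div_x : R;
  div_is_left : bool;
  landing : option 'I_n;
  wrapper : option 'I_m }.

(* The positions [istart, ..., istop] (inclusive), together with the indices
   in D of the two dividers that represent the interval. *)
Record del_interval (n m : nat) := DelInterval {
  istart : 'I_n;
  istop : 'I_n;
  left_div : 'I_m;
  right_div : 'I_m }.

Definition ipos n m (I : del_interval n m) : {set 'I_n} :=
  [set p : 'I_n | istart I <= p <= istop I]%N.

(* Null at the left, resp. right, end of the array. *)
Definition pos_before n (p : 'I_n) : option 'I_n :=
  if val p is p'.+1 then insub p' else None.
Definition pos_after n (p : 'I_n) : option 'I_n := insub (val p).+1.

Section DataStructure.
Variables (R : realType) (n m k : nat).
Variables (A : 'I_n -> apoint R m) (D : 'I_m -> divider R n m).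
(* The intervals represented in D, in the order in which they were added.
   This family is not available to the algorithm, which sees only A and D. *)
Variable I : 'I_k -> del_interval n m.

Definition x_sorted :=
  forall i j : 'I_n, (i <= j)%N -> (xy (A i)).1 <= (xy (A j)).1.

(* Nothing is assumed on the stored x-coordinates of the dividers, nor on the
   pointers of points that lie in no interval. *)
Definition represents :=
  [/\ forall i, (istart (I i) <= istop (I i))%N,
      forall i, div_is_left (D (left_div (I i))) /\
                landing (D (left_div (I i))) = pos_before (istart (I i)),
      forall i, ~~ div_is_left (D (right_div (I i))) /\
                landing (D (right_div (I i))) = pos_after (istop (I i)),
      injective (fun i => left_div (I i)) /\
      injective (fun i => right_div (I i))
    & forall d, exists i, d = left_div (I i) \/ d = right_div (I i)].

Definition marked (p : 'I_n) : bool := [exists i, p \in ipos (I i)].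

(* [I j] is the largest interval containing [I i]; among equal ranges, the one
   added last. *)
Definition largest_above (i j : 'I_k) :=
  ipos (I i) \subset ipos (I j) /\
  forall l, ipos (I i) \subset ipos (I l) ->
    (#|ipos (I l)| < #|ipos (I j)|)%N \/
    (#|ipos (I l)| = #|ipos (I j)| /\ (l <= j)%N).

(* |D| <= kappa * n / log n. *)
Definition invariant1 (kappa : nat) := (m * trunc_log 2 n <= kappa * n)%N.

Definition invariant2 := forall i j, largest_above i j ->
  wrapper (D (left_div (I i))) = Some (left_div (I j)) /\
  wrapper (D (right_div (I i))) = Some (right_div (I j)).

Definition invariant3 := forall i j,
  [\/ [disjoint ipos (I i) & ipos (I j)],
      ipos (I i) \subset ipos (I j)
    | ipos (I j) \subset ipos (I i)].

Definition invariant4 := forall p, marked p ->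
  exists i, [/\ p \in ipos (I i),
                left_par (A p) = Some (left_div (I i))
              & right_par (A p) = Some (right_div (I i))].

Definition invariant5 := forall i,
  wrapper (D (left_div (I i))) = Some (left_div (I i)) ->
  wrapper (D (right_div (I i))) = Some (right_div (I i)) ->
  (forall p, landing (D (left_div (I i))) = Some p -> ~~ marked p) /\
  (forall p, landing (D (right_div (I i))) = Some p -> ~~ marked p).

Definition unmarked_range (lo hi : 'I_n) : {set 'I_n} :=
  [set p : 'I_n | (lo <= p <= hi)%N && ~~ marked p].

Definition expressed (lo hi : 'I_n) (C : seq (point R)) :=
  C = [seq xy (A p) | p <- enum (unmarked_range lo hi)].

End DataStructure.

(** * Serial computation: a unit-cost real RAM *)

(* Programs over two unbounded memories, one of naturals and one of reals, both
   addressed by naturals (hence with indirect addressing), and with read access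
   to the fields of A and D.  Every node of an evaluated expression costs one
   step.  The arithmetic on naturals is restricted to addition, truncated
   subtraction and halving, so that t steps produce only numbers of
   O(t + log n) bits; reals have exact arithmetic and comparisons but no
   rounding. *)

Inductive nexp : Type :=
| NConst of nat
| NCell of nexp
| NAdd of nexp & nexp
| NSub of nexp & nexp
| NHalf of nexp
| NLeftPar of nexp
| NRightPar of nexp
| NIsLeft of nexp
| NLanding of nexp
| NWrapper of nexp.

Inductive rexp : Type :=
| RConst of nat
| RCell of nexp
| RX of nexp
| RY of nexp
| RDivX of nexp
| RAdd of rexp & rexp
| RSub of rexp & rexp
| RMul of rexp & rexp
| RDiv of rexp & rexp.

Inductive bexp : Type :=
| BNLe of nexp & nexp
| BRLe of rexp & rexp
| BNot of bexp
| BAnd of bexp & bexp.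

Inductive cmd : Type :=
| Skip
| NAssign of nexp & nexp
| RAssign of nexp & rexp
| Seq of cmd & cmd
| If of bexp & cmd & cmd
| While of bexp & cmd.

Fixpoint ncost (e : nexp) : nat :=
  match e with
  | NConst _ => 1
  | NCell e1 | NHalf e1 | NLeftPar e1 | NRightPar e1
  | NIsLeft e1 | NLanding e1 | NWrapper e1 => (ncost e1).+1
  | NAdd e1 e2 | NSub e1 e2 => (ncost e1 + ncost e2).+1
  end.

Fixpoint rcost (e : rexp) : nat :=
  match e with
  | RConst _ => 1
  | RCell a | RX a | RY a | RDivX a => (ncost a).+1
  | RAdd e1 e2 | RSub e1 e2 | RMul e1 e2 | RDiv e1 e2 =>
      (rcost e1 + rcost e2).+1
  end.

Fixpoint bcost (b : bexp) : nat :=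
  match b with
  | BNLe e1 e2 => (ncost e1 + ncost e2).+1
  | BRLe e1 e2 => (rcost e1 + rcost e2).+1
  | BNot b1 => (bcost b1).+1
  | BAnd b1 b2 => (bcost b1 + bcost b2).+1
  end.

Record state (R : realType) := State { nmem : nat -> nat; rmem : nat -> R }.

Definition update (T : Type) (f : nat -> T) (a : nat) (v : T) : nat -> T :=
  fun b => if b == a then v else f b.

(* As a machine value, null is 0 and a pointer to index i is i + 1. *)
Definition ptr_code n (p : option 'I_n) : nat :=
  if p is Some i then i.+1 else 0%N.

(* Reading a field at index a; out of bounds reads return dflt. *)
Definition read (n : nat) (T U : Type) (f : 'I_n -> T) (field : T -> U)
    (dflt : U) (a : nat) : U :=
  if insub a is Some i then field (f i) else dflt.

Section Semantics.
Variables (R : realType) (n m : nat).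
Variables (A : 'I_n -> apoint R m) (D : 'I_m -> divider R n m).

Fixpoint neval (s : state R) (e : nexp) : nat :=
  match e with
  | NConst c => c
  | NCell e1 => nmem s (neval s e1)
  | NAdd e1 e2 => (neval s e1 + neval s e2)%N
  | NSub e1 e2 => (neval s e1 - neval s e2)%N
  | NHalf e1 => (neval s e1)./2
  | NLeftPar e1 => read A (fun p => ptr_code (left_par p)) 0%N (neval s e1)
  | NRightPar e1 => read A (fun p => ptr_code (right_par p)) 0%N (neval s e1)
  | NIsLeft e1 => read D (fun d => nat_of_bool (div_is_left d)) 0%N (neval s e1)
  | NLanding e1 => read D (fun d => ptr_code (landing d)) 0%N (neval s e1)
  | NWrapper e1 => read D (fun d => ptr_code (wrapper d)) 0%N (neval s e1)
  end.

Fixpoint reval (s : state R) (e : rexp) : R :=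
  match e with
  | RConst c => c%:R
  | RCell a => rmem s (neval s a)
  | RX a => read A (fun p => (xy p).1) 0 (neval s a)
  | RY a => read A (fun p => (xy p).2) 0 (neval s a)
  | RDivX a => read D (@div_x R n m) 0 (neval s a)
  | RAdd e1 e2 => reval s e1 + reval s e2
  | RSub e1 e2 => reval s e1 - reval s e2
  | RMul e1 e2 => reval s e1 * reval s e2
  | RDiv e1 e2 => reval s e1 / reval s e2
  end.

Fixpoint beval (s : state R) (b : bexp) : bool :=
  match b with
  | BNLe e1 e2 => (neval s e1 <= neval s e2)%N
  | BRLe e1 e2 => reval s e1 <= reval s e2
  | BNot b1 => ~~ beval s b1
  | BAnd b1 b2 => beval s b1 && beval s b2
  end.

(* [exec c s t s']: started in s, the command c halts in s' after t steps. *)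
Inductive exec : cmd -> state R -> nat -> state R -> Prop :=
| ExecSkip s : exec Skip s 1 s
| ExecNAssign a e s :
    exec (NAssign a e) s (ncost a + ncost e).+1
      (State (update (nmem s) (neval s a) (neval s e)) (rmem s))
| ExecRAssign a e s :
    exec (RAssign a e) s (ncost a + rcost e).+1
      (State (nmem s) (update (rmem s) (neval s a) (reval s e)))
| ExecSeq c1 c2 s1 t1 s2 t2 s3 :
    exec c1 s1 t1 s2 -> exec c2 s2 t2 s3 -> exec (Seq c1 c2) s1 (t1 + t2) s3
| ExecIf b c1 c2 s t s' :
    exec (if beval s b then c1 else c2) s t s' ->
    exec (If b c1 c2) s (bcost b + t).+1 s'
| ExecWhileFalse b c s :
    ~~ beval s b -> exec (While b c) s (bcost b).+1 s
| ExecWhileTrue b c s1 t1 s2 t2 s3 :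
    beval s1 b -> exec c s1 t1 s2 -> exec (While b c) s2 t2 s3 ->
    exec (While b c) s1 (bcost b + t1 + t2).+1 s3.

End Semantics.

(* The arguments occupy the first cells; every other cell holds 0. *)
Definition init_state (R : realType) (args : seq nat) : state R :=
  State (nth 0%N args) (fun=> 0).

Definition bigO_log (T : nat -> nat) :=
  exists c n0 : nat, forall n, (n0 <= n)%N -> (T n <= c * trunc_log 2 n)%N.

(* Main.v *)
Require Import Defs.
From HB Require Import structures.
From mathcomp Require Import all_boot all_order all_algebra.
From mathcomp Require Import reals.
From mathcomp Require Import zify ring lra.

Set Implicit Arguments.
Unset Strict Implicit.
Unset Printing Implicit Defensive.

Import Order.TTheory GRing.Theory Num.Theory.

Local Open Scope ring_scope.

(* From any marked position, LeftPar, Wrapper and Landing lead to the start of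
   the maximal deletion interval around it, and the pointers of that start lead
   to its end; by Invariant 5 the neighbours of a maximal interval are unmarked.
   So the unmarked points closest to a position are found in constant time.

   Fix the common tangent, of slope t, and take an edge of each hull near the
   middle of its search range, with supporting lines l1 (left hull, slope s1)
   and l2 (right hull, slope s2).  If some point of the right hull is on or
   above l1 then t >= s1; if some point of the left hull is on or above l2 then
   t <= s2.  Otherwise s2 < s1, and l1 and l2 are compared at an abscissa c
   between the hulls: if l1 is above l2 at c, then l1 is above the whole right
   hull, so that t <= s1; if not, then t >= s2 by symmetry.  Each outcome
   discards half of one of the two ranges. *)

(** * Costs of commands *)

Fixpoint loop_free (c : cmd) : bool :=
  match c with
  | Seq c1 c2 | If _ c1 c2 => loop_free c1 && loop_free c2
  | While _ _ => false
  | _ => true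
  end.

(** The value on [While] is a dummy: the bound is claimed for loop-free commands only. *)
Fixpoint worst_cost (c : cmd) : nat :=
  match c with
  | Skip | While _ _ => 1
  | NAssign a e => (ncost a + ncost e).+1
  | RAssign a e => (ncost a + rcost e).+1
  | Seq c1 c2 => worst_cost c1 + worst_cost c2
  | If b c1 c2 => (bcost b + maxn (worst_cost c1) (worst_cost c2)).+1
  end.

Section Run.
Variables (R : realType) (n m : nat).
Variables (A : 'I_n -> apoint R m) (D : 'I_m -> divider R n m).

Fixpoint run (c : cmd) (s : state R) : state R :=
  match c with
  | NAssign a e =>
      State (update (nmem s) (neval A D s a) (neval A D s e)) (rmem s)
  | RAssign a e =>
      State (nmem s) (update (rmem s) (neval A D s a) (reval A D s e))
  | Seq c1 c2 => run c2 (run c1 s)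
  | If b c1 c2 => if beval A D s b then run c1 s else run c2 s
  | _ => s
  end.

Lemma exec_run c s : loop_free c ->
  exists2 t, (t <= worst_cost c)%N & exec A D c s t (run c s).
Proof.
elim: c s => [|a e|a e|c1 IH1 c2 IH2|b c1 IH1 c2 IH2|//] s /=.
- by exists 1%N => //; exact: ExecSkip.
- by move=> _; eexists; [|exact: ExecNAssign].
- by move=> _; eexists; [|exact: ExecRAssign].
- move=> /andP[lf1 lf2].
  have [t1 le1 ex1] := IH1 s lf1; have [t2 le2 ex2] := IH2 (run c1 s) lf2.
  by exists (t1 + t2)%N; [exact: leq_add | exact: ExecSeq ex1 ex2].
- move=> /andP[lf1 lf2].
  have [t1 le1 ex1] := IH1 s lf1; have [t2 le2 ex2] := IH2 s lf2.
  case: ifP => bs.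
  + by exists (bcost b + t1).+1; [lia | apply: ExecIf; rewrite bs].
  + by exists (bcost b + t2).+1; [lia | apply: ExecIf; rewrite bs].
Qed.

(** Each round lowers [mu], so there are at most [mu s] rounds; the successor in the bound pays for
    the last, failing test. *)
Lemma exec_while b c (inv : state R -> Prop) (mu : state R -> nat) s :
  loop_free c -> inv s ->
  (forall s', inv s' -> beval A D s' b ->
     inv (run c s') /\ (mu (run c s') < mu s')%N) ->
  exists t s', [/\ exec A D (While b c) s t s',
    (t <= (mu s).+1 * (bcost b + worst_cost c).+1)%N,
    inv s' & ~~ beval A D s' b].
Proof.
move=> lfc inv_s step; have [N] := ubnP (mu s).
elim: N s inv_s => // N IH s inv_s mu_s.
have [bs|nbs] := boolP (beval A D s b); last first.
  exists (bcost b).+1, s; split=> //; last by nia.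
  exact: ExecWhileFalse.
have [inv_s1 mu_s1] := step _ inv_s bs.
have [|t2 [s2 [ex2 le2 inv2 nb2]]] := IH _ inv_s1; first by lia.
have [t1 le1 ex1] := exec_run s lfc.
exists (bcost b + t1 + t2).+1, s2; split=> //; last by nia.
exact: ExecWhileTrue ex1 ex2.
Qed.

End Run.

(** The binary length of [d]. The doubling separates 0 from 1, so that halving a range of length 1
    is still progress. *)
Definition bits (d : nat) := trunc_log 2 d.*2.

Lemma bits_half d e : (0 < d)%N -> (e <= d./2)%N -> (bits e < bits d)%N.
Proof.
move=> d0 ed; rewrite /bits (trunc_log2_double d0) ltnS leq_trunc_log //; lia.
Qed.

Lemma bits_lt d n : (d < n)%N -> (bits d <= (trunc_log 2 n).+1)%N.
Proof.
by move=> dn; rewrite /bits -trunc_log2_double ?leq_trunc_log //; lia.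
Qed.

(** * Skipping deleted points *)

Definition Reg (r : nat) := NCell (NConst r).
Definition Index (p : nexp) := NSub p (NConst 1).
Definition NLt (e1 e2 : nexp) := BNLe (NAdd e1 (NConst 1)) e2.

(* For a position q of a maximal interval [a, b], these read the pointer codes
   of a - 1 and of b + 1, which are a and b + 2 (or 0 at the end of the
   array). *)
Definition NStart (q : nexp) :=
  NLanding (Index (NWrapper (Index (NLeftPar q)))).
Definition NStop (q : nexp) :=
  NLanding (Index (NWrapper (Index (NRightPar (NStart q))))).

(* The pointers of an unmarked q are arbitrary.  The right end is therefore not
   found through q.RightPar but through the first point of the interval that
   q.LeftPar leads to, whose pointers are reliable. *)
Definition BMarked (q : nexp) :=
  BAnd (NLt (NConst 0) (NLeftPar q))
    (BAnd (NLt (NConst 0) (NIsLeft (Index (NLeftPar q))))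
      (BAnd (BNLe (NStart q) q)
        (BNot (BAnd (NLt (NConst 0) (NStop q))
                    (BNLe (NStop q) (NAdd q (NConst 1))))))).

Definition CPrev (r : nat) (q : nexp) :=
  If (BMarked q) (NAssign (NConst r) (Index (NStart q))) (NAssign (NConst r) q).
Definition CNext (r : nat) (q : nexp) :=
  If (BMarked q) (NAssign (NConst r) (Index (NStop q))) (NAssign (NConst r) q).

Section Neighbours.
Variables (R : realType) (n m : nat).
Variables (A : 'I_n -> apoint R m) (D : 'I_m -> divider R n m).

(** The expressions evaluated in [s0] contain no memory cell, so every state gives the same
    values. *)
Let s0 := init_state R [::].

Definition start_of (q : nat) := neval A D s0 (NStart (NConst q)).
Definition stop_of (q : nat) := neval A D s0 (NStop (NConst q)).
Definition is_marked (q : nat) := beval A D s0 (BMarked (NConst q)).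
Definition prev_unmarked (q : nat) :=
  if is_marked q then (start_of q).-1 else q.
Definition next_unmarked (q : nat) :=
  if is_marked q then (stop_of q).-1 else q.

Lemma run_CPrev r q s :
  run A D (CPrev r q) s =
  State (update (nmem s) r (prev_unmarked (neval A D s q))) (rmem s).
Proof.
have marked_q : beval A D s (BMarked q) = is_marked (neval A D s q) by [].
rewrite /prev_unmarked -marked_q -subn1.
by rewrite -[LHS]/(if beval A D s (BMarked q) then _ else _); case: ifP.
Qed.

Lemma run_CNext r q s :
  run A D (CNext r q) s =
  State (update (nmem s) r (next_unmarked (neval A D s q))) (rmem s).
Proof.
have marked_q : beval A D s (BMarked q) = is_marked (neval A D s q) by [].
rewrite /next_unmarked -marked_q -subn1.
by rewrite -[LHS]/(if beval A D s (BMarked q) then _ else _); case: ifP.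
Qed.

Lemma read_ord (N : nat) T U (f : 'I_N -> T) (field : T -> U) dflt (i : 'I_N) :
  read f field dflt i = field (f i).
Proof. by rewrite /read valK. Qed.

Variables (k : nat) (I : 'I_k -> del_interval n m).

Lemma largest_aboveW i j : largest_above I i j -> largest_above I j j.
Proof. by case=> sij max; split=> // l sjl; exact/max/(subset_trans sij). Qed.

Lemma largest_above_exists i : exists j, largest_above I i j.
Proof.
(* The lexicographic order on (size, rank), encoded in one number. *)
pose key l := (#|ipos (I l)| * k + l)%N.
have [j sij max] := @arg_maxnP _ i (fun l => ipos (I i) \subset ipos (I l))
  key (subxx _).
exists j; split=> // l /max; rewrite /key => le.
have [] := (ltn_ord l, ltn_ord j).
case: (ltngtP #|ipos (I l)| #|ipos (I j)|) => [|gt|eq] ? ?; [by left|nia|].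
by right; nia.
Qed.

Hypothesis laminar : invariant3 I.

(** By laminarity every interval through a point of a maximal [I j] is nested in it, for a strictly
    larger one would also contain [I i]. Hence all dividers recorded at such a point have those of
    [I j] as wrappers. *)
Lemma largest_above_meet i j l p : largest_above I i j ->
  p \in ipos (I j) -> p \in ipos (I l) -> largest_above I l j.
Proof.
move=> [sij max] pj pl.
have meet l' : p \in ipos (I l') ->
  ipos (I j) \subset ipos (I l') \/ ipos (I l') \subset ipos (I j).
  move=> pl'; case: (laminar j l') => [dis| |]; [|by left|by right].
  by have := disjointFr dis pj; rewrite pl'.
have sub l' : p \in ipos (I l') -> ipos (I l') \subset ipos (I j).
  move=> /meet[sjl'|//]; case: (max l' (subset_trans sij sjl')).
    by move=> lt; have := subset_leq_card sjl'; lia.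
  by case=> eq _; have /eqP -> : ipos (I j) == ipos (I l');
    rewrite // eqEcard sjl' eq leqnn.
split; first exact: sub.
move=> l' sll'; have pl' : p \in ipos (I l') by exact: (subsetP sll').
have := subset_leq_card (sub _ pl'); rewrite leq_eqVlt.
case/orP=> [/eqP eq|]; last by left.
(* A tie: [I l'] has the range of [I j], so it contains [I i], and the tie rule known for [I i]
   applies. *)
have eqs : ipos (I l') = ipos (I j) by apply/eqP; rewrite eqEcard sub //= eq.
by apply: max; rewrite eqs.
Qed.

Hypothesis repr : represents D I.
Hypothesis wrap : invariant2 D I.
Hypothesis pars : invariant4 A I.
Hypothesis lands : invariant5 D I.

Lemma read_div U (field : divider R n m -> U) dflt d :
  read D field dflt (ptr_code (Some d) - 1) = field (D d).
Proof. by rewrite /= subn1 read_ord. Qed.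

Lemma start_in j : istart (I j) \in ipos (I j).
Proof. by rewrite inE leqnn; case: repr => ->. Qed.

(** Only the left pointer of [q] is assumed, so [q] may be unmarked. Its wrapper leads to the start
    of a maximal [I j]. That start is marked, so its right pointer is the right divider of an
    interval through it, whose wrapper is the right divider of [I j]. *)
Lemma start_stop_of (q : 'I_n) i : left_par (A q) = Some (left_div (I i)) ->
  exists j, [/\ largest_above I i j, start_of q = istart (I j)
    & stop_of q = ptr_code (pos_after (istop (I j)))].
Proof.
case: repr => _ landL landR _ _ lq.
have [j mij] := largest_above_exists i; exists j.
have startq : start_of q = istart (I j).
  rewrite /start_of /= read_ord lq read_div.
  have [-> _] := wrap mij; rewrite read_div.
  have [_ ->] := landL j; rewrite /pos_before.
  (* At position 0 the landing is null, of code 0; elsewhere it is the preceding position. Either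
     way the code equals the start. *)
  by case: (istart _) => -[|p] //= ltp; rewrite insubT //=; lia.
split=> //.
have -> : stop_of q = read D (fun d => ptr_code (landing d)) 0%N
  (read D (fun d => ptr_code (wrapper d)) 0%N
    (read A (fun p => ptr_code (right_par p)) 0%N (start_of q) - 1) - 1) by [].
rewrite startq read_ord.
have /pars[l [jl _ ->]] : marked I (istart (I j)).
  by apply/existsP; exists j; exact: start_in.
have mlj := largest_above_meet mij (start_in j) jl.
rewrite read_div; have [_ ->] := wrap mlj; rewrite read_div.
by have [_ ->] := landR j.
Qed.

(** The code of the position after [istop] is [istop + 2], or 0 at the end of the array, where the
    upper bound on [q] is automatic. *)
Lemma in_ipos_stop_of j (q : 'I_n) : (q \in ipos (I j)) =
  (istart (I j) <= q)%N && ~~ [&& 0 < ptr_code (pos_after (istop (I j)))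
    & ptr_code (pos_after (istop (I j))) <= q + 1]%N.
Proof.
rewrite inE /pos_after; case: insubP => [p _ /= ->|] /=; last first.
  by rewrite -leqNgt andbT => ?; have := ltn_ord q; lia.
by lia.
Qed.

(** Whatever the left pointer, the test succeeds only if [q] lies in a genuine maximal interval; for
    a marked [q], [invariant4] makes the pointer lead to one around [q]. *)
Lemma is_markedE (q : 'I_n) : is_marked q = marked I q.
Proof.
have -> : is_marked q = [&& 0 < read A (fun p => ptr_code (left_par p)) 0 q,
    0 < read D (fun d => nat_of_bool (div_is_left d)) 0
          (read A (fun p => ptr_code (left_par p)) 0 q - 1),
    start_of q <= q & ~~ [&& 0 < stop_of q & stop_of q <= q + 1]]%N by [].
rewrite read_ord; case lq: (left_par (A q)) => [d|] /=; last first.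
  by have [/pars[i [_]]|//] := boolP (marked I q); rewrite lq.
rewrite subn1 read_ord /= lt0b; case: repr => _ landL landR _ cover.
(* A left pointer to a Right divider fails the flag test; by [invariant4] a marked point has no such
   pointer. *)
have [i [def_d|def_d]] := cover d; last first.
  have [/negbTE notL _] := landR i; rewrite def_d notL /=.
  have [/pars[i' [_]]|//] := boolP (marked I q).
  rewrite lq => -[d_i'] _.
  by have [] := landL i'; rewrite -d_i' def_d notL.
have [isL _] := landL i; rewrite def_d isL /=.
rewrite def_d in lq; have [j [mij -> ->]] := start_stop_of lq.
rewrite -in_ipos_stop_of; apply/idP/idP => [qj|/pars[i' [qi']]].
  by apply/existsP; exists j.
rewrite lq => -[eq_div] _.
have [_ [injL _]] : True /\ injective (fun i => left_div (I i)) /\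
  injective (fun i => right_div (I i)) by case: repr.
by rewrite -(injL _ _ eq_div) in qi'; apply: (subsetP mij.1).
Qed.

(** False beyond the array, so that [unmarked p] carries the bound [p < n]. *)
Definition unmarked (p : nat) :=
  if insub p is Some q then ~~ marked I q else false.

Lemma unmarkedE (p : 'I_n) : unmarked p = ~~ marked I p.
Proof. by rewrite /unmarked valK. Qed.

Lemma unmarked_lt p : unmarked p -> (p < n)%N.
Proof. by rewrite /unmarked; case: insubP. Qed.

Lemma unmarked_ipos p j : unmarked p ->
  (p < istart (I j))%N \/ (istop (I j) < p)%N.
Proof.
move=> um; pose q := Ordinal (unmarked_lt um).
have : ~~ marked I q by rewrite -unmarkedE.
have /contraNN h : q \in ipos (I j) -> marked I q.
  by move=> ?; apply/existsP; exists j.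
by move/h; rewrite inE /=; lia.
Qed.

Lemma marked_interval (q : 'I_n) : marked I q -> exists j,
  [/\ (istart (I j) <= q <= istop (I j))%N,
      start_of q = istart (I j),
      stop_of q = ptr_code (pos_after (istop (I j))),
      (forall p : nat, p.+1 = istart (I j) -> unmarked p)
    & (forall p : nat, p = (istop (I j)).+1 -> (p < n)%N -> unmarked p)].
Proof.
move=> /pars[i [qi lq _]]; have [j [mij startq stopq]] := start_stop_of lq.
(* A maximal interval is its own wrapper, so [invariant5] applies to it. *)
have [wrapL wrapR] := wrap (largest_aboveW mij).
have [landL landR] := lands wrapL wrapR.
case: repr => _ /(_ j)[_ defL] /(_ j)[_ defR] _ _.
exists j; split=> //.
- by have := subsetP mij.1 _ qi; rewrite inE.
- move=> p def_p; have ltp : (p < n)%N by have := ltn_ord (istart (I j)); lia.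
  rewrite -[p]/(val (Ordinal ltp)) unmarkedE; apply: landL.
  by rewrite defL /pos_before /= -def_p insubT.
- move=> p def_p ltp; rewrite -[p]/(val (Ordinal ltp)) unmarkedE; apply: landR.
  by rewrite defR /pos_after /= -def_p insubT.
Qed.

(** The unmarked [l] ensures that a maximal interval around [q] does not start at position 0; the
    position before its start is unmarked, and those from its start to [q] are all marked. *)
Lemma prev_unmarkedP l q : (l <= q < n)%N -> unmarked l ->
  [/\ (l <= prev_unmarked q <= q)%N, unmarked (prev_unmarked q)
    & forall r, (prev_unmarked q < r <= q)%N -> ~~ unmarked r].
Proof.
move=> /andP[lq ltq] uml; pose o := Ordinal ltq.
have := is_markedE o; rewrite /prev_unmarked /= => ->.
have [/marked_interval[j [/= inj -> _ uml' _]]|numq] := boolP (marked I o).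
  have [ltl|] := unmarked_ipos j uml; last by lia.
  split; [lia | by apply: uml'; rewrite prednK //; lia |].
  by move=> r inr; apply/negP => /(unmarked_ipos j); lia.
by split; [lia | rewrite -[q]/(val o) unmarkedE | move=> r; lia].
Qed.

Lemma next_unmarkedP q h : (q <= h)%N -> unmarked h ->
  [/\ (q <= next_unmarked q <= h)%N, unmarked (next_unmarked q)
    & forall r, (q <= r < next_unmarked q)%N -> ~~ unmarked r].
Proof.
move=> qh umh; have lth := unmarked_lt umh.
have ltq : (q < n)%N by lia.
pose o := Ordinal ltq.
have := is_markedE o; rewrite /next_unmarked /= => ->.
have [/marked_interval[j [/= inj _ -> _ umr']]|numq] := boolP (marked I o).
  have [|lth'] := unmarked_ipos j umh; first by lia.
  have lts : ((istop (I j)).+1 < n)%N by lia.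
  rewrite /pos_after insubT /=; split; [lia | exact: umr' |].
  by move=> r inr; apply/negP => /(unmarked_ipos j); lia.
by split; [lia | rewrite -[q]/(val o) unmarkedE | move=> r; lia].
Qed.

End Neighbours.

(** * Hulls and tangents *)

Section Hulls.
Variable R : realType.
Implicit Types (C : seq (point R)) (p q u v w : point R).

Lemma in_convex_hull_segment C u v (t : R) : u \in C -> v \in C ->
  0 <= t <= 1 ->
  in_convex_hull C (t * u.1 + (1 - t) * v.1, t * u.2 + (1 - t) * v.2).
Proof.
move=> uC vC t01.
pose iu := Ordinal (etrans (index_mem u C) uC).
pose iv := Ordinal (etrans (index_mem v C) vC).
(* Adding the two weights also covers the case [u = v], where the indices coincide. *)
have sumE (F : 'I_(size C) -> R) :
  \sum_i (t * (i == iu)%:R + (1 - t) * (i == iv)%:R) * F i =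
  t * F iu + (1 - t) * F iv.
  have pick a k : \sum_i a * (i == k)%:R * F i = a * F k.
    rewrite (bigD1 k) //= eqxx mulr1 big1 ?addr0 // => i /negbTE ->.
    by rewrite mulr0 mul0r.
  by under eq_bigr do rewrite mulrDl; rewrite big_split /= !pick.
have tnthE w (lt : (index w C < size C)%N) : w \in C ->
  tnth (in_tuple C) (Ordinal lt) = w.
  by move=> wC; rewrite (tnth_nth w) /= nth_index.
exists (fun i => t * (i == iu)%:R + (1 - t) * (i == iv)%:R); split.
- by move=> i; apply: addr_ge0; apply: mulr_ge0; rewrite ?ler0n //; lra.
- by have := sumE (fun=> 1); under eq_bigr do rewrite mulr1; move=> ->; lra.
- by rewrite sumE !tnthE.
- by rewrite sumE !tnthE.
Qed.

Lemma in_convex_hull_below C (a b : R) q :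
  {in C, forall p, p.2 <= a * p.1 + b} -> in_convex_hull C q ->
  q.2 <= a * q.1 + b.
Proof.
move=> below [w [w0 w1 -> ->]].
rewrite mulr_sumr -[b]mulr1 -w1 mulr_sumr -big_split /=.
apply: ler_sum => i _; rewrite mulrCA [b * _]mulrC -mulrDr.
by apply: ler_wpM2l => //; exact/below/mem_tnth.
Qed.

Lemma upper_hull_uniq C : upper_hull C -> uniq C.
Proof.
case=> _ sC _; apply: sorted_uniq sC; first by move=> ? ? ?; exact: lt_trans.
by move=> ?; exact: ltxx.
Qed.

(** Otherwise [v] would lie on or below the segment from [u] to [w], hence on or below the hull of
    the other vertices. *)
Lemma upper_hull_concave C u v w : upper_hull C ->
  u \in C -> v \in C -> w \in C -> u.1 < v.1 < w.1 ->
  u.2 * (w.1 - v.1) + w.2 * (v.1 - u.1) < v.2 * (w.1 - u.1).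
Proof.
move=> hull uC vC wC /andP[uv vw]; rewrite ltNge; apply/negP => below.
case: (hull) => _ _ /(_ v vC); apply.
have remC z : z \in C -> z.1 != v.1 -> z \in rem v C.
  move=> zC; rewrite (mem_rem_uniq _ (upper_hull_uniq hull)) inE /= zC andbT.
  by apply: contraNneq => ->.
have uw : 0 < w.1 - u.1 by lra.
pose t := (w.1 - v.1) / (w.1 - u.1).
have t01 : 0 <= t <= 1.
  by rewrite divr_ge0 ?ler_pdivrMr //=; lra.
exists (t * u.1 + (1 - t) * w.1, t * u.2 + (1 - t) * w.2); split.
- apply: in_convex_hull_segment => //; apply: remC => //; lra.
- by rewrite /= /t; field; lra.
- have -> : (t * u.1 + (1 - t) * w.1, t * u.2 + (1 - t) * w.2).2 =
    (u.2 * (w.1 - v.1) + w.2 * (v.1 - u.1)) / (w.1 - u.1).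
    by rewrite /= /t; field; lra.
  by rewrite ler_pdivlMr.
Qed.

(* Among the segments joining the two sets, one that is highest at the
   separating abscissa c spans a common tangent. *)
Lemma common_tangent_exists C1 C2 (c : R) : C1 != [::] -> C2 != [::] ->
  (forall p q, p \in C1 -> q \in C2 -> p.1 < c < q.1) ->
  exists a b : R,
    [/\ {in C1, forall p, p.2 <= a * p.1 + b},
        {in C2, forall p, p.2 <= a * p.1 + b},
        exists2 p, p \in C1 & p.2 = a * p.1 + b
      & exists2 p, p \in C2 & p.2 = a * p.1 + b].
Proof.
rewrite -!size_eq0 -!lt0n => n1 n2 sep.
pose pt C i : point R := tnth (in_tuple C) i.
(* The ordinate at [c] of the line through [p] and [q]. *)
pose height p q : R := (p.2 * (q.1 - c) + q.2 * (c - p.1)) / (q.1 - p.1).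
have [[i j] _ max] := @Order.TotalTheory.arg_maxP _ R _
  (Ordinal n1, Ordinal n2) predT
  (fun ij => height (pt C1 ij.1) (pt C2 ij.2)) isT.
have {}max p q : p \in C1 -> q \in C2 ->
  height p q <= height (pt C1 i) (pt C2 j).
  move=> /(nthP p)[i' lti' <-] /(nthP q)[j' ltj' <-].
  rewrite -[nth p C1 i']/(nth p (in_tuple C1) (Ordinal lti')) -tnth_nth.
  rewrite -[nth q C2 j']/(nth q (in_tuple C2) (Ordinal ltj')) -tnth_nth.
  exact: max (Ordinal lti', Ordinal ltj') isT.
have : pt C1 i \in C1 by exact: mem_tnth.
have : pt C2 j \in C2 by exact: mem_tnth.
move: (pt C1 i) (pt C2 j) max => p q max qC pC.
have /andP[pc cq] := sep p q pC qC.
have pq : 0 < q.1 - p.1 by lra.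
pose a := (q.2 - p.2) / (q.1 - p.1); pose b := p.2 - a * p.1.
have onp : p.2 = a * p.1 + b by rewrite /b; ring.
have onq : q.2 = a * q.1 + b by rewrite /b /a; field; lra.
have top : height p q = a * c + b by rewrite /height onp onq; field; lra.
rewrite top in max; clearbody a b; exists a, b.
split; [| |by exists p|by exists q].
- move=> r rC; have /andP[rc _] := sep r q rC qC.
  have := max r q rC qC; rewrite /height ler_pdivrMr; last by lra.
  rewrite onq => h; have qc : 0 < q.1 - c by lra.
  by rewrite -(ler_pM2r qc); lra.
- move=> r rC; have /andP[_ cr] := sep p r pC rC.
  have := max p r pC rC; rewrite /height ler_pdivrMr; last by lra.
  rewrite onp => h; have cp : 0 < c - p.1 by lra.
  by rewrite -(ler_pM2r cp); lra.
Qed.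

End Hulls.

(** * Concave chains and the position of the tangency points *)

Section Chains.
Variables (R : realType) (x y : nat -> R).
Implicit Types S : pred nat.

Definition slope a b := (y b - y a) / (x b - x a).
Definition line a s (z : R) := y a + s * (z - x a).

Definition edge S a b :=
  [/\ S a, S b, (a < b)%N & forall r, (a < r < b)%N -> ~~ S r].

Definition chain S :=
  (forall p q, S p -> S q -> (p < q)%N -> x p < x q) /\
  (forall a b p, edge S a b -> S p -> y p <= line a (slope a b) (x p)).

Variables (t e : R).

Definition below S := forall p, S p -> y p <= t * x p + e.

(** The invariant of the search, for a fixed tangent of slope [t] and intercept [e]. *)
Definition touches S l h :=
  exists p, [/\ S p, (l <= p <= h)%N & y p = t * x p + e].

Lemma line_slope S a b : chain S -> edge S a b ->
  line a (slope a b) (x b) = y b.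
Proof.
move=> [mono _] [Sa Sb ab _]; have := mono _ _ Sa Sb ab.
by rewrite /line /slope => lt; field; lra.
Qed.

(** Right of [a] the chain is below a line through [a] of slope at most [t], so a tangency point
    there forces [a] onto the tangent as well. *)
Lemma touches_left S a b l h : chain S -> below S -> edge S a b ->
  slope a b <= t -> touches S l h -> (l <= a)%N -> touches S l a.
Proof.
move=> [mono above] bel ab ts [p [Sp lph onp]] la.
have [Sa _ _ _] := ab; have [pa|ap] := leqP p a.
  by exists p; split=> //; lia.
exists a; split=> //; first by lia.
have := above _ _ _ ab Sp; have := bel a Sa; have := mono _ _ Sa Sp ap.
rewrite /line; move: (slope a b) ts => s ts xap ya yp; nra.
Qed.

Lemma touches_right S a b l h : chain S -> below S -> edge S a b ->
  t <= slope a b -> touches S l h -> (b <= h)%N -> touches S b h.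
Proof.
move=> ch bel ab ts [p [Sp lph onp]] bh; have [mono above] := ch.
have [Sa Sb ltab gap] := ab; have [bp|pb] := leqP b p.
  by exists p; split=> //; lia.
exists b; split=> //; first by lia.
have := above _ _ _ ab Sp; have := bel b Sb; have := mono _ _ Sp Sb pb.
have := line_slope ch ab.
rewrite /line; move: (slope a b) ts => s ts yb xpb leb yp; nra.
Qed.

Variables (S1 S2 : pred nat) (c : R).
(** The abscissa [c] may be that of a vertex, so it separates only weakly; strictness between the
    hulls is recorded apart. *)
Hypothesis sep : forall p q, S1 p -> S2 q -> x p <= c <= x q /\ x p < x q.
Hypotheses (ch1 : chain S1) (ch2 : chain S2) (be1 : below S1) (be2 : below S2).
Variables (l1 h1 a1 b1 l2 h2 a2 b2 : nat).
Hypotheses (to1 : touches S1 l1 h1) (to2 : touches S2 l2 h2).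
Hypotheses (la1 : (l1 <= a1 <= h1)%N) (la2 : (l2 <= a2 <= h2)%N).
Hypotheses (Sa1 : S1 a1) (Sa2 : S2 a2).
(** A range reduced to one position need not have an edge; [a1] is then that position. *)
Hypothesis ed1 : (l1 < h1)%N -> edge S1 a1 b1 /\ (b1 <= h1)%N.
Hypothesis ed2 : (l2 < h2)%N -> edge S2 a2 b2 /\ (b2 <= h2)%N.

Let line1 := line a1 (slope a1 b1).
Let line2 := line a2 (slope a2 b2).

(** The tangent is on or below [line1] at a left tangency point, and on or above it at [x a2],
    further right; so its slope is at least that of [line1]. *)
Lemma drop_right1 : (l1 < h1)%N -> line1 (x a2) <= y a2 -> touches S1 l1 a1.
Proof.
move=> lt1 above; have [E1 _] := ed1 lt1.
apply: (touches_left ch1 be1 E1 _ to1); last by lia.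
have [p [Sp _ onp]] := to1; have := ch1.2 _ _ _ E1 Sp; have := be2 Sa2.
have [_] := sep Sp Sa2; move: above; rewrite /line1 /line.
move: (slope a1 b1) => s; nra.
Qed.

Lemma drop_left2 : (l2 < h2)%N -> line2 (x a1) <= y a1 -> touches S2 b2 h2.
Proof.
move=> lt2 above; have [E2 leb2] := ed2 lt2.
apply: (touches_right ch2 be2 E2 _ to2); last by lia.
have [p [Sp _ onp]] := to2; have := ch2.2 _ _ _ E2 Sp; have := be1 Sa1.
have [_] := sep Sa1 Sp; move: above; rewrite /line2 /line.
move: (slope a2 b2) => s; nra.
Qed.

(** It suffices that the right tangency point is on or below [line1]: the tangent is on or above
    [line1] at [x a1], so its slope is then at most that of [line1]. *)
Lemma drop_left1 : (l1 < h1)%N -> y a2 < line1 (x a2) ->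
  ((l2 < h2)%N -> y a1 < line2 (x a1) /\ line2 c <= line1 c) ->
  touches S1 b1 h1.
Proof.
move=> lt1 above cross; have [E1 leb1] := ed1 lt1.
apply: (touches_right ch1 be1 E1 _ to1); last by lia.
have [p [Sp lp onp]] := to2; have [_ lt_ap] := sep Sa1 Sp.
have yp : y p <= line1 (x p).
  have [lt2|eq2] := ltnP l2 h2; last first.
    by have -> : p = a2 by [lia]; exact: ltW.
  have [E2 _] := ed2 lt2; have := ch2.2 _ _ _ E2 Sp.
  have [low cr] := cross lt2; have [/andP[_ cp] _] := sep Sa1 Sp.
  have [_ lt12] := sep Sa1 Sa2.
  move: above low cr; rewrite /line1 /line2 /line.
  move: (slope a1 b1) (slope a2 b2) => s1 s2 above low cr yp.
  (* [line2] is above [line1] at [x a1] but not at [c], so it has the smaller slope and stays on or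
     below [line1] to the right of [c]. *)
  have s21 : s2 < s1 by nra.
  nra.
have := be1 Sa1; move: yp; rewrite /line1 /line.
move: (slope a1 b1) => s; nra.
Qed.

Lemma drop_right2 : (l2 < h2)%N -> y a1 < line2 (x a1) ->
  ((l1 < h1)%N -> y a2 < line1 (x a2) /\ line1 c <= line2 c) ->
  touches S2 l2 a2.
Proof.
move=> lt2 above cross; have [E2 leb2] := ed2 lt2.
apply: (touches_left ch2 be2 E2 _ to2); last by lia.
have [p [Sp lp onp]] := to1; have [_ lt_pa] := sep Sp Sa2.
have yp : y p <= line2 (x p).
  have [lt1|eq1] := ltnP l1 h1; last first.
    by have -> : p = a1 by [lia]; exact: ltW.
  have [E1 _] := ed1 lt1; have := ch1.2 _ _ _ E1 Sp.
  have [low cr] := cross lt1; have [/andP[pc _] _] := sep Sp Sa2.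
  have [_ lt12] := sep Sa1 Sa2.
  move: above low cr; rewrite /line1 /line2 /line.
  move: (slope a1 b1) (slope a2 b2) => s1 s2 above low cr yp.
  have s21 : s2 < s1 by nra.
  nra.
have := be2 Sa2; move: yp; rewrite /line2 /line.
move: (slope a2 b2) => s; nra.
Qed.

End Chains.

(** * Expressed hulls as chains of array positions *)

Section Expressed.
Variables (R : realType) (n m k : nat).
Variables (A : 'I_n -> apoint R m) (I : 'I_k -> del_interval n m).

Definition xat (a : nat) : R := read A (fun p => (xy p).1) 0 a.
Definition yat (a : nat) : R := read A (fun p => (xy p).2) 0 a.
Definition within (lo hi : nat) : pred nat :=
  [pred p | (lo <= p <= hi)%N && unmarked I p].

Lemma withinP (lo hi : 'I_n) p : within lo hi p ->
  exists2 q : 'I_n, p = q & q \in unmarked_range I lo hi.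
Proof.
move=> /andP[lohi um]; exists (Ordinal (unmarked_lt um)) => //.
by rewrite inE lohi -unmarkedE.
Qed.

Lemma within_ord (lo hi : 'I_n) (q : 'I_n) :
  within lo hi q = (q \in unmarked_range I lo hi).
Proof. by rewrite /within /= unmarkedE inE. Qed.

Variables (lo hi : 'I_n) (C : seq (point R)).
Hypothesis exC : expressed A I lo hi C.

Lemma expressedP u : reflect (exists2 p, within lo hi p & u = (xat p, yat p))
  (u \in C).
Proof.
rewrite exC; apply: (iffP mapP) => [[q]|[p]].
  rewrite mem_enum => qin ->; exists (val q); first by rewrite within_ord.
  by rewrite /xat /yat !read_ord -surjective_pairing.
move=> /withinP[q -> qin] ->; exists q; first by rewrite mem_enum.
by rewrite /xat /yat !read_ord -surjective_pairing.
Qed.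

Hypotheses (sA : x_sorted A) (hull : upper_hull C).

(** [x_sorted] gives only a weak inequality. Strictness comes from the hull, whose vertices have
    distinct abscissas: equal ones would give equal ranks in the enumeration. *)
Lemma expressed_lt p q : within lo hi p -> within lo hi q -> (p < q)%N ->
  xat p < xat q.
Proof.
move=> /withinP[{}p -> pin] /withinP[{}q -> qin] pq.
rewrite /xat !read_ord lt_neqAle sA ?(ltnW pq) // andbT.
case: hull => _; set r := (fun _ => _); rewrite exC => sC _.
have : uniq [seq (xy (A i)).1 | i <- enum (unmarked_range I lo hi)].
  rewrite -[X in uniq X]/(map (fst \o (fun i => xy (A i))) _) map_comp.
  apply: (@sorted_uniq _ (fun u v : R => u < v)); first exact: lt_trans.
    exact: ltxx.
  by rewrite sorted_map.
move/(uniqP 0) => inj; apply: contraTneq pq => eq_x.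
have := inj (index p (enum (unmarked_range I lo hi)))
            (index q (enum (unmarked_range I lo hi))).
rewrite !inE size_map !index_mem !mem_enum !(nth_map p) ?index_mem ?mem_enum //.
rewrite !nth_index ?mem_enum // => /(_ pin qin eq_x) eq_i.
have := nth_index p (_ : p \in enum (unmarked_range I lo hi)).
by rewrite eq_i nth_index ?mem_enum // => -> //; rewrite ltnn.
Qed.

(** A vertex outside the edge forms with its ends a triple to which concavity applies; none lies
    strictly between the ends, which are consecutive. *)
Lemma expressed_chain : chain xat yat (within lo hi).
Proof.
split; first exact: expressed_lt.
move=> a b p [Sa Sb ab gap] Sp; rewrite /line /slope.
have inC q : within lo hi q -> (xat q, yat q) \in C.
  by move=> ?; apply/expressedP; exists q.
have xab := expressed_lt Sa Sb ab.
have dab : 0 < xat b - xat a by lra.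
suff : (yat p - yat a) * (xat b - xat a) <= (yat b - yat a) * (xat p - xat a).
  move=> le; rewrite -lerBlDl mulrAC ler_pdivlMr //.
have [pa|ap|->] := ltngtP p a; last by rewrite !subrr mul0r mulr0.
  have := upper_hull_concave hull (inC _ Sp) (inC _ Sa) (inC _ Sb).
  by rewrite /= (expressed_lt Sp Sa pa) xab => /(_ isT); nra.
have [pb|bp|->] := ltngtP p b; last by [].
  by have := gap p; rewrite ap pb Sp => /(_ isT).
have := upper_hull_concave hull (inC _ Sa) (inC _ Sb) (inC _ Sp).
by rewrite /= (expressed_lt Sb Sp bp) xab => /(_ isT); nra.
Qed.

End Expressed.

(** * The search *)

(* Cells 2 to 5 hold the ends of the two search ranges, cells 6 to 9 the
   current edges (6, 7) and (8, 9); real cells 1 and 2 hold their slopes, and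
   real cell 0 an abscissa separating the hulls. *)
Definition CEdge (l h a b r : nat) :=
  Seq (CPrev a (NHalf (NAdd (Reg l) (Reg h))))
    (Seq (CNext b (NAdd (NHalf (NAdd (Reg l) (Reg h))) (NConst 1)))
      (RAssign (NConst r) (RDiv (RSub (RY (Reg b)) (RY (Reg a)))
                                (RSub (RX (Reg b)) (RX (Reg a)))))).

Definition RLine (a r : nat) (z : rexp) :=
  RAdd (RY (Reg a)) (RMul (RCell (NConst r)) (RSub z (RX (Reg a)))).

(** The branches are justified in order by [drop_right1], [drop_left2], [drop_left1] and
    [drop_right2]. The length tests guard against ranges of one position, whose edge is
    meaningless. *)
Definition CDrop :=
  If (BAnd (NLt (Reg 2) (Reg 3)) (BRLe (RLine 6 1 (RX (Reg 8))) (RY (Reg 8))))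
    (NAssign (NConst 3) (Reg 6))
  (If (BAnd (NLt (Reg 4) (Reg 5)) (BRLe (RLine 8 2 (RX (Reg 6))) (RY (Reg 6))))
    (NAssign (NConst 4) (Reg 9))
  (If (BAnd (NLt (Reg 2) (Reg 3))
        (BNot (BAnd (NLt (Reg 4) (Reg 5))
          (BNot (BRLe (RLine 8 2 (RCell (NConst 0)))
                      (RLine 6 1 (RCell (NConst 0))))))))
    (NAssign (NConst 2) (Reg 7))
    (NAssign (NConst 5) (Reg 8)))).

Definition CStep := Seq (Seq (CEdge 2 3 6 7 1) (CEdge 4 5 8 9 2)) CDrop.

Definition BUnfinished :=
  NLt (NConst 0) (NAdd (NSub (Reg 3) (Reg 2)) (NSub (Reg 5) (Reg 4))).

(** The program is given no separating abscissa; that of the last vertex of the left hull is stored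
    instead. *)
Definition CInit :=
  Seq (Seq (CNext 2 (Reg 2)) (CPrev 3 (Reg 3)))
    (Seq (Seq (CNext 4 (Reg 4)) (CPrev 5 (Reg 5)))
      (RAssign (NConst 0) (RX (Reg 3)))).

Definition COutput :=
  Seq (NAssign (NConst 0) (Reg 2)) (NAssign (NConst 1) (Reg 4)).

Definition CTangent := Seq CInit (Seq (While BUnfinished CStep) COutput).

(** Each of the two ranges contributes at most [(trunc_log 2 n).+1] to the measure of the loop. *)
Definition tangent_cost (n : nat) : nat :=
  (worst_cost CInit +
   ((2 * (trunc_log 2 n).+1).+1 * (bcost BUnfinished + worst_cost CStep).+1 +
    worst_cost COutput))%N.

(** * One round of the search *)

Section Machine.
Variables (R : realType) (n m : nat).
Variables (A : 'I_n -> apoint R m) (D : 'I_m -> divider R n m).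

Lemma run_Seq c1 c2 s : run A D (Seq c1 c2) s = run A D c2 (run A D c1 s).
Proof. by []. Qed.

Lemma run_CEdge l h a b r s (mid := (nmem s l + nmem s h)./2) :
  [&& l != a, l != b, h != a, h != b & a != b] ->
  run A D (CEdge l h a b r) s =
  State (update (update (nmem s) a (prev_unmarked A D mid))
           b (next_unmarked A D (mid + 1)))
        (update (rmem s) r (slope (xat A) (yat A) (prev_unmarked A D mid)
                              (next_unmarked A D (mid + 1)))).
Proof.
case/and5P=> la lb ha hb ab.
rewrite /CEdge !run_Seq run_CPrev run_CNext [LHS]/= /update eqxx.
by rewrite (negbTE la) (negbTE ha) (negbTE ab) eqxx.
Qed.

Lemma run_edges s :
  let mid1 := (nmem s 2 + nmem s 3)./2 in
  let mid2 := (nmem s 4 + nmem s 5)./2 in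
  let a1 := prev_unmarked A D mid1 in let b1 := next_unmarked A D (mid1 + 1) in
  let a2 := prev_unmarked A D mid2 in let b2 := next_unmarked A D (mid2 + 1) in
  let s' := run A D (Seq (CEdge 2 3 6 7 1) (CEdge 4 5 8 9 2)) s in
  [/\ [/\ nmem s' 2 = nmem s 2, nmem s' 3 = nmem s 3, nmem s' 4 = nmem s 4
        & nmem s' 5 = nmem s 5],
      [/\ nmem s' 6 = a1, nmem s' 7 = b1, nmem s' 8 = a2 & nmem s' 9 = b2],
      rmem s' 0 = rmem s 0,
      rmem s' 1 = slope (xat A) (yat A) a1 b1
    & rmem s' 2 = slope (xat A) (yat A) a2 b2].
Proof.
move=> mid1 mid2 a1 b1 a2 b2 s'; by rewrite /s' run_Seq run_CEdge // run_CEdge.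
Qed.

Variables (k : nat) (I : 'I_k -> del_interval n m).
Hypothesis repr : represents D I.
Hypothesis wrap : invariant2 D I.
Hypothesis laminar : invariant3 I.
Hypothesis pars : invariant4 A I.
Hypothesis lands : invariant5 D I.

(** [l] and, if [l < h], also [h] witness unmarked positions on either side of the midpoint. The
    edge straddles it, so keeping [l] to the left end or the right end to [h] leaves at most half of
    the length. *)
Lemma middle_edge lo hi l h (mid := (l + h)./2) :
  within I lo hi l -> within I lo hi h -> (l <= h)%N ->
  [/\ within I lo hi (prev_unmarked A D mid),
      (l <= prev_unmarked A D mid <= mid)%N
    & (l < h)%N ->
      edge (within I lo hi) (prev_unmarked A D mid)
        (next_unmarked A D (mid + 1)) /\
      (mid < next_unmarked A D (mid + 1) <= h)%N].
Proof.
move=> /andP[lol uml] /andP[loh umh] lh.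
have lth := unmarked_lt umh.
have lmid : (l <= mid < n)%N by rewrite /mid; lia.
have [lp ump gapp] := prev_unmarkedP laminar repr wrap pars lands lmid uml.
have Sp : within I lo hi (prev_unmarked A D mid) by apply/andP; split=> //; lia.
split=> // ltlh.
have midh : (mid + 1 <= h)%N by rewrite /mid; lia.
have [ln umn gapn] := next_unmarkedP laminar repr wrap pars lands midh umh.
split; last by lia.
split=> //; [by apply/andP; split=> //; lia | by lia |].
move=> r inr; rewrite /within /= negb_and; apply/orP; right.
by have [rm|mr] := leqP r mid; [apply: gapp|apply: gapn]; lia.
Qed.

Section Loop.
Variables (lo1 hi1 lo2 hi2 : nat) (t e c : R).
Let S1 := within I lo1 hi1.
Let S2 := within I lo2 hi2.
Hypotheses (ch1 : chain (xat A) (yat A) S1) (ch2 : chain (xat A) (yat A) S2).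
Hypotheses (be1 : below (xat A) (yat A) t e S1).
Hypotheses (be2 : below (xat A) (yat A) t e S2).
Hypothesis sep : forall p q, S1 p -> S2 q ->
  xat A p <= c <= xat A q /\ xat A p < xat A q.

Definition bracket lo hi l h :=
  [/\ within I lo hi l, within I lo hi h, (l <= h)%N
    & touches (xat A) (yat A) t e (within I lo hi) l h].

Definition search_inv (s : state R) :=
  [/\ bracket lo1 hi1 (nmem s 2) (nmem s 3),
      bracket lo2 hi2 (nmem s 4) (nmem s 5) & rmem s 0 = c].

Definition search_measure (s : state R) :=
  (bits (nmem s 3 - nmem s 2) + bits (nmem s 5 - nmem s 4))%N.

Lemma search_step s : search_inv s -> beval A D s BUnfinished ->
  search_inv (run A D CStep s) /\
  (search_measure (run A D CStep s) < search_measure s)%N.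
Proof.
move=> [br1 br2 cs] unfinished; rewrite /= in unfinished.
rewrite /CStep run_Seq; have := run_edges s; cbv zeta.
move: (run A D _ s) => s' [[e2 e3 e4 e5] [e6 e7 e8 e9] r0 r1 r2].
have [Sl1 Sh1 lh1 to1] := br1; have [Sl2 Sh2 lh2 to2] := br2.
have [Sa1 la1 ed1] := middle_edge Sl1 Sh1 lh1.
have [Sa2 la2 ed2] := middle_edge Sl2 Sh2 lh2.
rewrite -{}e6 -{}e7 in r1 Sa1 la1 ed1; rewrite -{}e8 -{}e9 in r2 Sa2 la2 ed2.
set a1 := nmem s' 6 in r1 Sa1 la1 ed1; set b1 := nmem s' 7 in r1 ed1.
set a2 := nmem s' 8 in r2 Sa2 la2 ed2; set b2 := nmem s' 9 in r2 ed2.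
have ed1' : (nmem s 2 < nmem s 3)%N -> edge S1 a1 b1 /\ (b1 <= nmem s 3)%N.
  by move=> /ed1[? /andP[]].
have ed2' : (nmem s 4 < nmem s 5)%N -> edge S2 a2 b2 /\ (b2 <= nmem s 5)%N.
  by move=> /ed2[? /andP[]].
have la1' : (nmem s 2 <= a1 <= nmem s 3)%N by lia.
have la2' : (nmem s 4 <= a2 <= nmem s 5)%N by lia.
have ha1 : (a1 - nmem s 2 <= (nmem s 3 - nmem s 2)./2)%N by lia.
have ha2 : (a2 - nmem s 4 <= (nmem s 5 - nmem s 4)./2)%N by lia.
have hb1 : (nmem s 2 < nmem s 3)%N ->
  (nmem s 3 - b1 <= (nmem s 3 - nmem s 2)./2)%N by move=> /ed1[_]; lia.
have hb2 : (nmem s 4 < nmem s 5)%N ->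
  (nmem s 5 - b2 <= (nmem s 5 - nmem s 4)./2)%N by move=> /ed2[_]; lia.
rewrite /search_measure /CDrop /= e2 e3 e4 e5 r1 r2 r0 cs !addn1.
rewrite -/a1 -/a2 -/b1 -/b2.
rewrite -/(xat A a1) -/(xat A a2) -/(yat A a1) -/(yat A a2).
set z1 := (X in X <= yat A a2); set z2 := (X in X <= yat A a1).
have above1 : (nmem s 2 < nmem s 3)%N && (z1 <= yat A a2) = false ->
    (nmem s 2 < nmem s 3)%N -> yat A a2 < z1.
  by move=> no lt; move: no; rewrite lt /= => /negbT; rewrite -ltNge.
have above2 : (nmem s 4 < nmem s 5)%N && (z2 <= yat A a1) = false ->
    (nmem s 4 < nmem s 5)%N -> yat A a1 < z2.
  by move=> no lt; move: no; rewrite lt /= => /negbT; rewrite -ltNge.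
case: ifP => [/andP[lt1 up1]|/above1 {}above1].
  rewrite /search_inv /update /= e2 e4 e5 r0; split; last first.
    by rewrite ltn_add2r; apply: bits_half; rewrite ?subn_gt0.
  split=> //; split=> //; first by case/andP: la1'.
  exact: (drop_right1 sep ch1 be1 be2 to1 la1' la2' Sa1 Sa2 ed1' ed2' lt1 up1).
case: ifP => [/andP[lt2 up2]|/above2 {}above2].
  have [[_ Sb2 _ _] inb2] := ed2 lt2.
  rewrite /search_inv /update /= e2 e3 e5 r0; split; last first.
    by rewrite ltn_add2l; apply: bits_half; rewrite ?subn_gt0 ?hb2.
  split=> //; split=> //; first by case/andP: inb2.
  exact: (drop_left2 sep ch2 be1 be2 to2 la1' la2' Sa1 Sa2 ed1' ed2' lt2 up2).
case: ifP => [/andP[lt1 cross]|no].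
  have [[_ Sb1 _ _] inb1] := ed1 lt1.
  rewrite /search_inv /update /= e3 e4 e5 r0; split; last first.
    by rewrite ltn_add2r; apply: bits_half; rewrite ?subn_gt0 ?hb1.
  split=> //; split=> //; first by case/andP: inb1.
  apply: (drop_left1 sep ch1 ch2 be1 to1 to2 la1' la2' Sa1 Sa2 ed1' ed2' lt1).
    exact: above1.
  by move=> lt2; split; [exact: above2 | move: cross; rewrite lt2 negbK].
(* If the right range were a single position, failure of the third test would make the left one
   single too, and the loop would have stopped. *)
have lt2 : (nmem s 4 < nmem s 5)%N.
  move: no; case: (ltnP (nmem s 4)) => //= le2; rewrite andbT => ge1.
  by move: unfinished; clear -ge1 le2; lia.
rewrite /search_inv /update /= e2 e3 e4 r0; split; last first.
  by rewrite ltn_add2l; apply: bits_half; rewrite ?subn_gt0.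
split=> //; split=> //; first by case/andP: la2'.
apply: (drop_right2 sep ch1 ch2 be2 to1 to2 la1' la2' Sa1 Sa2 ed1' ed2' lt2).
  exact: above2.
move=> lt1; split; first exact: above1.
by move: no; rewrite lt1 lt2 /= negbK => /negbT; rewrite -ltNge => /ltW.
Qed.

End Loop.
End Machine.

(** * The whole search, for hulls given from left to right *)

Section Tangent.
Variables (R : realType) (n m k : nat).
Variables (A : 'I_n -> apoint R m) (D : 'I_m -> divider R n m).
Variable I : 'I_k -> del_interval n m.
Hypothesis sA : x_sorted A.
Hypothesis repr : represents D I.
Hypothesis wrap : invariant2 D I.
Hypothesis laminar : invariant3 I.
Hypothesis pars : invariant4 A I.
Hypothesis lands : invariant5 D I.

Lemma next_in_range lo hi p : within I lo hi p ->
  (lo <= next_unmarked A D lo <= p)%N /\ within I lo hi (next_unmarked A D lo).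
Proof.
move=> /andP[inp ump]; have lop : (lo <= p)%N by lia.
have [inx umx _] := next_unmarkedP laminar repr wrap pars lands lop ump.
by split=> //; apply/andP; split=> //; lia.
Qed.

Lemma prev_in_range lo hi p : within I lo hi p -> (hi < n)%N ->
  (p <= prev_unmarked A D hi <= hi)%N /\ within I lo hi (prev_unmarked A D hi).
Proof.
move=> /andP[inp ump] lthi; have phi : (p <= hi < n)%N by lia.
have [inx umx _] := prev_unmarkedP laminar repr wrap pars lands phi ump.
by split=> //; apply/andP; split=> //; lia.
Qed.

Lemma run_CInit s
    (h1 := prev_unmarked A D (nmem s 3)) (s' := run A D CInit s) :
  [/\ nmem s' 2 = next_unmarked A D (nmem s 2), nmem s' 3 = h1,
      nmem s' 4 = next_unmarked A D (nmem s 4),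
      nmem s' 5 = prev_unmarked A D (nmem s 5) & rmem s' 0 = xat A h1].
Proof. by rewrite /s' /CInit !run_Seq !run_CPrev !run_CNext. Qed.

(** Only cells 2 to 5 are constrained on entry, so this also applies after [CSwap]. *)
Lemma exec_CTangent s (lo1 hi1 lo2 hi2 : 'I_n) C1 C2 (c : R) :
  nmem s 2 = lo1 -> nmem s 3 = hi1 -> nmem s 4 = lo2 -> nmem s 5 = hi2 ->
  upper_hull C1 -> upper_hull C2 ->
  expressed A I lo1 hi1 C1 -> expressed A I lo2 hi2 C2 ->
  (forall p q, p \in C1 -> q \in C2 -> p.1 < c < q.1) ->
  exists (t : nat) (s' : state R) (p1 p2 : 'I_n),
    [/\ exec A D CTangent s t s',
        (t <= tangent_cost n)%N,
        nmem s' 0 = p1 /\ nmem s' 1 = p2,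
        p1 \in unmarked_range I lo1 hi1 /\ p2 \in unmarked_range I lo2 hi2
      & upper_common_tangent C1 C2 (xy (A p1)) (xy (A p2))].
Proof.
move=> e2 e3 e4 e5 hull1 hull2 ex1 ex2 sepC.
have [ne1 _ _] := hull1; have [ne2 _ _] := hull2.
have [a [b [below1 below2 [u1 u1C on1] [u2 u2C on2]]]] :=
  common_tangent_exists ne1 ne2 sepC.
have ch1 := expressed_chain ex1 sA hull1.
have ch2 := expressed_chain ex2 sA hull2.
have in1 p : within I lo1 hi1 p -> (xat A p, yat A p) \in C1.
  by move=> ?; apply/(expressedP ex1); exists p.
have in2 p : within I lo2 hi2 p -> (xat A p, yat A p) \in C2.
  by move=> ?; apply/(expressedP ex2); exists p.
have be1 : below (xat A) (yat A) a b (within I lo1 hi1).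
  by move=> p /in1/below1.
have be2 : below (xat A) (yat A) a b (within I lo2 hi2).
  by move=> p /in2/below2.
have /(expressedP ex1)[t1 St1 def1] := u1C; rewrite def1 /= in on1.
have /(expressedP ex2)[t2 St2 def2] := u2C; rewrite def2 /= in on2.
have [lt1 Sl1] := next_in_range St1.
have [lt2 Sl2] := next_in_range St2.
have [th1 Sh1] := prev_in_range St1 (ltn_ord hi1).
have [th2 Sh2] := prev_in_range St2 (ltn_ord hi2).
have nt1 : (next_unmarked A D lo1 <= t1 <= prev_unmarked A D hi1)%N by lia.
have nt2 : (next_unmarked A D lo2 <= t2 <= prev_unmarked A D hi2)%N by lia.
pose h1 := prev_unmarked A D hi1.
have sep p q : within I lo1 hi1 p -> within I lo2 hi2 q ->
    xat A p <= xat A h1 <= xat A q /\ xat A p < xat A q.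
  move=> Sp Sq; have /= := sepC _ _ (in1 _ Sp) (in2 _ Sq).
  have /= := sepC _ _ (in1 _ Sh1) (in2 _ Sq).
  have [ph1 _] := prev_in_range Sp (ltn_ord hi1).
  have ple : xat A p <= xat A h1.
    case/andP: ph1 => + _; rewrite leq_eqVlt => /orP[/eqP -> //|lt].
    exact: ltW (ch1.1 _ _ Sp Sh1 lt).
  by rewrite -/h1; lra.
have lfI : loop_free CInit by [].
have lfS : loop_free CStep by [].
have lfO : loop_free COutput by [].
have [tI leI exI] := exec_run A D s lfI.
have [i2 i3 i4 i5 r0] := run_CInit s.
have start : search_inv A I lo1 hi1 lo2 hi2 a b (xat A h1) (run A D CInit s).
  rewrite /search_inv i2 i3 i4 i5 r0 e2 e3 e4 e5; split=> //; split=> //.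
  - by case/andP: nt1; exact: leq_trans.
  - by exists t1.
  - by case/andP: nt2; exact: leq_trans.
  - by exists t2.
have [tW [s1 [exW leW [br1 br2 _] done]]] := exec_while lfS start
  (search_step repr wrap laminar pars lands ch1 ch2 be1 be2 sep).
have [tO leO exO] := exec_run A D s1 lfO.
have [Sp1 Sq1 le1 [p1 [Sp1' in_p1 onp1]]] := br1.
have [Sp2 Sq2 le2 [p2 [Sp2' in_p2 onp2]]] := br2.
(* The loop stops with both ranges reduced to one position, which must be the tangency point. *)
have [eqp1 eqp2] : p1 = nmem s1 2 /\ p2 = nmem s1 4.
  by move: done in_p1 in_p2; rewrite /=; clear; lia.
have /withinP[q1 def_q1 q1in] := Sp1'; have /withinP[q2 def_q2 q2in] := Sp2'.
exists (tI + (tW + tO))%N, (run A D COutput s1), q1, q2; split=> //.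
- by apply: ExecSeq exI _; apply: ExecSeq exW exO.
- apply: leq_add leI (leq_add _ leO); apply: leq_trans leW _.
  rewrite leq_mul2r ltnS /search_measure i2 i3 i4 i5 e2 e3 e4 e5 mul2n -addnn.
  have bits_range (lo hi l h : nat) : within I lo hi h ->
      (bits (h - l) <= (trunc_log 2 n).+1)%N.
    case/andP=> _ /unmarked_lt lth; apply: bits_lt.
    exact: leq_ltn_trans (leq_subr _ _) lth.
  by rewrite (leq_add (bits_range _ _ _ _ Sh1) (bits_range _ _ _ _ Sh2)) orbT.
- by rewrite /= /update /= -eqp1 -eqp2.
- exists a, b; split.
  + by move=> q [] /in_convex_hull_below; apply.
  + have := in1 _ Sp1'; move: onp1; rewrite def_q1 /xat /yat !read_ord.
    by rewrite -surjective_pairing.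
  + have := in2 _ Sp2'; move: onp2; rewrite def_q2 /xat /yat !read_ord.
    by rewrite -surjective_pairing.
Qed.

End Tangent.

(** * Hulls given in either order *)

Definition CSwap :=
  Seq (Seq (NAssign (NConst 6) (Reg 2)) (Seq (NAssign (NConst 2) (Reg 4))
        (NAssign (NConst 4) (Reg 6))))
      (Seq (NAssign (NConst 6) (Reg 3)) (Seq (NAssign (NConst 3) (Reg 5))
        (NAssign (NConst 5) (Reg 6)))).

Definition CSwapOutput :=
  Seq (NAssign (NConst 6) (Reg 0)) (Seq (NAssign (NConst 0) (Reg 1))
    (NAssign (NConst 1) (Reg 6))).

Definition CFirst := Seq (CNext 6 (Reg 2)) (CNext 8 (Reg 4)).
Definition BFirst := NLt (Reg 6) (Reg 8).

(** As [A] is sorted, the left hull is the one whose first vertex has the smaller position. *)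
Definition CMain :=
  Seq CFirst
    (If BFirst CTangent (Seq CSwap (Seq CTangent CSwapOutput))).

Definition main_cost (n : nat) : nat :=
  (worst_cost CFirst + (bcost BFirst +
    (worst_cost CSwap + (tangent_cost n + worst_cost CSwapOutput))).+1)%N.

Lemma main_cost_log : bigO_log main_cost.
Proof.
rewrite /main_cost /tangent_cost.
move: (worst_cost CFirst) (bcost BFirst) (worst_cost CSwap) => a b c.
move: (worst_cost CSwapOutput) (worst_cost CInit) (worst_cost COutput) => d e f.
move: (bcost BUnfinished + worst_cost CStep)%N => g.
(* For [L >= 1] the number of rounds satisfies [(2 * L.+1).+1 <= 5 * L], whence the 5; the factor
   [L] absorbs the other constants. *)
exists (a + b + c + d + e + f + 5 * g.+1 + 1)%N, 2 => n n2.
have := trunc_log_gt0 2 n; rewrite n2 /= => L.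
by move: (trunc_log 2 n) L => L; nia.
Qed.

Lemma upper_common_tangentC (R : realType) (C1 C2 : seq (point R)) p1 p2 :
  upper_common_tangent C1 C2 p1 p2 -> upper_common_tangent C2 C1 p2 p1.
Proof.
move=> [a [b [bel t1 t2]]]; exists a, b; split=> // q.
by case=> ?; apply: bel; [right | left].
Qed.

Theorem theorem1 (R : realType) :
  exists P : cmd, forall kappa : nat, exists T : nat -> nat, bigO_log T /\
    forall (n m k : nat) (A : 'I_n -> apoint R m) (D : 'I_m -> divider R n m)
           (I : 'I_k -> del_interval n m),
      x_sorted A -> represents D I ->
      invariant1 n m kappa -> invariant2 D I -> invariant3 I ->
      invariant4 A I -> invariant5 D I ->
    forall (lo1 hi1 lo2 hi2 : 'I_n) (C1 C2 : seq (point R)),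
      upper_hull C1 -> upper_hull C2 ->
      expressed A I lo1 hi1 C1 -> expressed A I lo2 hi2 C2 ->
      separable C1 C2 ->
    exists (t : nat) (s : state R) (p1 p2 : 'I_n),
      [/\ exec A D P
            (init_state R [:: n; m; nat_of_ord lo1; nat_of_ord hi1;
                              nat_of_ord lo2; nat_of_ord hi2]) t s,
          (t <= T n)%N,
          nmem s 0 = nat_of_ord p1 /\ nmem s 1 = nat_of_ord p2,
          p1 \in unmarked_range I lo1 hi1 /\ p2 \in unmarked_range I lo2 hi2
        & upper_common_tangent C1 C2 (xy (A p1)) (xy (A p2))].
Proof.
exists CMain => kappa; exists main_cost; split; first exact: main_cost_log.
move=> n m k A D I sA repr _ wrap laminar pars lands lo1 hi1 lo2 hi2 C1 C2.
move=> hull1 hull2 ex1 ex2 [c sep]; set s := init_state R _.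
have lfF : loop_free CFirst by [].
have [tF leF exF] := exec_run A D s lfF.
set s' := run A D CFirst s in exF.
have [f2 f3 f4 f5] : [/\ nmem s' 2 = lo1, nmem s' 3 = hi1, nmem s' 4 = lo2
  & nmem s' 5 = hi2] by rewrite /s' /CFirst run_Seq !run_CNext.
have [f6 f8] : nmem s' 6 = next_unmarked A D lo1 /\
  nmem s' 8 = next_unmarked A D lo2 by rewrite /s' /CFirst run_Seq !run_CNext.
have first lo hi C : upper_hull C -> expressed A I lo hi C ->
    exists2 q : 'I_n, next_unmarked A D lo = q & xy (A q) \in C.
  move=> [ne _ _] ex.
  have [u /(expressedP ex)[p Sp _]] : exists u, u \in C.
    by case: C ne {ex} => // u C _; exists u; exact: mem_head.
  have [_ Sx] := next_in_range repr wrap laminar pars lands Sp.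
  have [q eq_q _] := withinP Sx; exists q => //.
  apply/(expressedP ex); exists (next_unmarked A D lo) => //.
  by rewrite eq_q /xat /yat !read_ord -surjective_pairing.
have [q1 eq1 in1] := first _ _ _ hull1 ex1.
have [q2 eq2 in2] := first _ _ _ hull2 ex2.
(* The contrapositive of weak sortedness turns strict order of abscissas into strict order of
   positions. *)
have order (p q : 'I_n) : (xy (A p)).1 < (xy (A q)).1 -> (p < q)%N.
  by rewrite ltnNge => lt; apply/negP => /sA; rewrite leNgt lt.
have BF : beval A D s' BFirst = (q1 < q2)%N.
  by rewrite /= f6 f8 eq1 eq2 addn1.
case: sep => sep.
  have lt12 : (q1 < q2)%N.
    by apply: order; have /andP[] := sep _ _ in1 in2; exact: lt_trans.
  have [t [s1 [p1 [p2 [ex le out pin tan]]]]] := exec_CTangent sA repr wrap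
    laminar pars lands f2 f3 f4 f5 hull1 hull2 ex1 ex2 sep.
  exists (tF + (bcost BFirst + t).+1)%N, s1, p1, p2; split=> //.
    by apply: ExecSeq exF _; apply: ExecIf; rewrite BF lt12.
  by rewrite /main_cost; lia.
have nlt12 : (q1 < q2)%N = false.
  apply/negbTE; rewrite -leqNgt ltnW //; apply: order.
  by have /andP[] := sep _ _ in1 in2; exact: lt_trans.
have lfS : loop_free CSwap by [].
have lfO : loop_free CSwapOutput by [].
have [tS leS exS] := exec_run A D s' lfS.
have [t [s1 [p1 [p2 [ex le out pin tan]]]]] := exec_CTangent sA repr wrap
  laminar pars lands (s := run A D CSwap s') f4 f5 f2 f3 hull2 hull1 ex2 ex1
  (fun p q pC qC => sep q p qC pC).
have [tO leO exO] := exec_run A D s1 lfO.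
exists (tF + (bcost BFirst + (tS + (t + tO))).+1)%N, (run A D CSwapOutput s1).
exists p2, p1; split.
- apply: ExecSeq exF _; apply: ExecIf; rewrite BF nlt12.
  by apply: ExecSeq exS _; apply: ExecSeq ex exO.
- by rewrite /main_cost; lia.
- by rewrite /= /update /=; case: out.
- by case: pin.
- exact: upper_common_tangentC.
Qed.
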